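(* For all $\Sigma\cup\{\alpha\}\subseteq\mathit{Fm}$, $\Sigma\models_{\mathrm{PPRL}}\alpha$ if and only if there is $\Delta\subseteq\Sigma$ such that $\mathrm{var}(\Delta)\subseteq\mathrm{var}(\alpha)$ and $\Delta\models_{\mathrm{PRL}}\alpha$. Moreover, such a $\Delta$ can be chosen finite.
   Context: Language $\mathcal{L}=\{\land,\lor,\longrightarrow,\neg,I,C,0,1\}$ with arities $2,2,2,1,1,1,0,0$; $\mathit{Fm}$ is the set of formulas over a countably infinite set $V$ of variables; $\mathrm{var}(\varphi)$ is the set of variables of $\varphi$, $\mathrm{var}(\Delta)=\bigcup_{\delta\in\Delta}\mathrm{var}(\delta)$. A quasi-Boolean algebra is an algebra $\langle Q,\land,\lor,\neg,0,1\rangle$ which is a bounded distributive lattice with $\neg\neg a=a$ and $\neg(a\lor b)=\neg a\land\neg b$. A pre-rough algebra is an $\mathcal{L}$-algebra $\mathbf{R}$ (universe $R$) whose $\{\land,\lor,\neg,0,1\}$-reduct is quasi-Boolean and such that for all $a,b\in R$: $I1=1$; $I(a\land b)=Ia\land Ib$; $\neg Ia\lor Ia=1$; $Ia\longrightarrow a=1$; $Ca=\neg I\neg a$; $a\longrightarrow b=(\neg Ia\lor Ib)\land(\neg Ca\lor Cb)$; and $Ca\longrightarrow Cb=1$ and $Ia\longrightarrow Ib=1$ imply $a\longrightarrow b=1$. $\Sigma\models_{\mathrm{PRL}}\alpha$ iff for every pre-rough algebra $\mathbf{R}$ and every homomorphism $v:\mathbf{Fm}\to\mathbf{R}$, $v[\Sigma]\subseteq\{1\}$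 implies $v(\alpha)=1$. For a pre-rough algebra $\mathbf{R}$, $\mathbf{R}^\#=\mathbf{R}\oplus\mathbf{1}$ has universe $R\cup\{\omega\}$ ($\omega\notin R$), constants $0,1$ as in $\mathbf{R}$, and every operation of arity $\ge1$ agrees with $\mathbf{R}$ on arguments in $R$ and returns $\omega$ if some argument is $\omega$. $\Sigma\models_{\mathrm{PPRL}}\alpha$ iff for every pre-rough algebra $\mathbf{R}$ and every homomorphism $v^\#:\mathbf{Fm}\to\mathbf{R}^\#$, $v^\#[\Sigma]\subseteq\{1,\omega\}$ implies $v^\#(\alpha)\in\{1,\omega\}$. *)

(* Defs.v *)
From mathcomp Require Import all_boot all_classical.

Set Implicit Arguments.
Unset Strict Implicit.
Unset Printing Implicit Defensive.

Local Open Scope classical_set_scope.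

(* [imp] is a primitive operation of the signature: the equation expressing it
   through the other operations is one of the axioms of pre-rough algebras. *)
Record algebra : Type := Algebra {
  carrier :> Type;
  meet : carrier -> carrier -> carrier;
  join : carrier -> carrier -> carrier;
  imp : carrier -> carrier -> carrier;
  neg : carrier -> carrier;
  opI : carrier -> carrier;
  opC : carrier -> carrier;
  zero : carrier;
  one : carrier
}.

Arguments meet {_} _ _.
Arguments join {_} _ _.
Arguments imp {_} _ _.
Arguments neg {_} _.
Arguments opI {_} _.
Arguments opC {_} _.
Arguments zero {_}.
Arguments one {_}.

Record homomorphism (A B : algebra) (h : A -> B) : Prop := Homomorphism {
  hom_meet : {morph h : x y / meet x y};
  hom_join : {morph h : x y / join x y};
  hom_imp : {morph h : x y / imp x y};
  hom_neg : {morph h : x / neg x};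
  hom_opI : {morph h : x / opI x};
  hom_opC : {morph h : x / opC x};
  hom_zero : h zero = zero;
  hom_one : h one = one
}.

Inductive formula (V : Type) : Type :=
  | Var of V
  | And of formula V & formula V
  | Or of formula V & formula V
  | Imp of formula V & formula V
  | Neg of formula V
  | FI of formula V
  | FC of formula V
  | Bot
  | Top.

Arguments Bot {V}.
Arguments Top {V}.

Definition Fm (V : Type) : algebra :=
  @Algebra (formula V) (@And V) (@Or V) (@Imp V) (@Neg V) (@FI V) (@FC V)
    Bot Top.

Fixpoint var (V : Type) (phi : formula V) : set V :=
  match phi with
  | Var x => [set x]
  | And a b | Or a b | Imp a b => var a `|` var b
  | Neg a | FI a | FC a => var a
  | Bot | Top => set0
  end.

Definition vars (V : Type) (Delta : set (Fm V)) : set V :=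
  \bigcup_(delta in Delta) var delta.

(* The axioms do not require [zero <> one]: the one-element algebra is
   a bounded distributive lattice, and is quasi-Boolean and pre-rough. *)
Record bounded_distributive_lattice (A : algebra) : Prop :=
  BoundedDistributiveLattice {
  meetA : associative (@meet A);
  meetC : commutative (@meet A);
  joinA : associative (@join A);
  joinC : commutative (@join A);
  meet_joinK : forall a b : A, meet a (join a b) = a;
  join_meetK : forall a b : A, join a (meet a b) = a;
  meet_joinDl : left_distributive (@meet A) (@join A);
  join0a : left_id zero (@join A);
  meet1a : left_id one (@meet A)
}.

Record quasi_boolean (A : algebra) : Prop := QuasiBoolean {
  quasi_boolean_lattice : bounded_distributive_lattice A;
  negK : involutive (@neg A);
  neg_join : forall a b : A, neg (join a b) = meet (neg a) (neg b)
}.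

Record pre_rough (A : algebra) : Prop := PreRough {
  pre_rough_quasi_boolean : quasi_boolean A;
  opI_one : opI one = one :> A;
  opI_meet : forall a b : A, opI (meet a b) = meet (opI a) (opI b);
  opI_em : forall a : A, join (neg (opI a)) (opI a) = one;
  opI_imp : forall a : A, imp (opI a) a = one;
  opC_def : forall a : A, opC a = neg (opI (neg a));
  imp_def : forall a b : A,
    imp a b = meet (join (neg (opI a)) (opI b)) (join (neg (opC a)) (opC b));
  imp_one : forall a b : A,
    imp (opC a) (opC b) = one -> imp (opI a) (opI b) = one -> imp a b = one
}.

Definition infectious1 (T : Type) (f : T -> T) (x : option T) : option T :=
  if x is Some a then Some (f a) else None.

Definition infectious2 (T : Type) (f : T -> T -> T) (x y : option T) :
    option T :=
  match x, y with
  | Some a, Some b => Some (f a b)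
  | _, _ => None
  end.

(* The universe of R (+) 1 is [option R], with [None] as the new element. *)
Definition sharp (R : algebra) : algebra :=
  @Algebra (option R)
    (infectious2 meet) (infectious2 join) (infectious2 imp)
    (infectious1 neg) (infectious1 opI) (infectious1 opC)
    (Some zero) (Some one).

Definition omega {R : algebra} : sharp R := None.

Definition PRL_entails (V : Type) (Sigma : set (Fm V)) (alpha : Fm V) : Prop :=
  forall (R : algebra) (v : Fm V -> R), pre_rough R -> homomorphism v ->
    v @` Sigma `<=` [set one] -> v alpha = one.

Definition PPRL_entails (V : Type) (Sigma : set (Fm V)) (alpha : Fm V) : Prop :=
  forall (R : algebra) (v : Fm V -> sharp R), pre_rough R -> homomorphism v ->
    v @` Sigma `<=` [set one; omega] -> [set one; omega] (v alpha).

(* Main.v *)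
(** Equivalence: given a valuation in [R], sending the variables outside
    [alpha] to omega makes omega of every formula with such a variable, so that
    only the premises over [var alpha] constrain the valuation of [alpha].
    Conversely, a valuation in [R#] that keeps [alpha] away from omega restricts
    to an [R]-valuation of the variables of [alpha].

    Finiteness: pre-rough algebras form a quasivariety, hence, without any proof
    calculus, the relation "some finite part of [Sigma] forces [a = b]" is a
    congruence of [Fm] whose quotient is pre-rough and satisfies [Sigma]. If
    [Sigma] entails [alpha], the class of [alpha] is therefore that of [Top]. *)
From mathcomp Require Import all_boot all_classical.
Require Import Defs.

Local Open Scope classical_set_scope.
Local Open Scope card_scope.

Lemma hom_comp {A B D : algebra} (g : B -> D) (f : A -> B) :
  homomorphism g -> homomorphism f -> homomorphism (g \o f).
Proof.
move=> [gm gj gi gn gI gC g0 g1] [fm fj fi fn fI fC f0 f1].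
by split=> [x y|x y|x y|x|x|x||] /=;
  rewrite (fm, fj, fi, fn, fI, fC, f0, f1) (gm, gj, gi, gn, gI, gC, g0, g1).
Qed.

Definition homE {A B : algebra} {h : A -> B} (hh : homomorphism h) :=
  (hom_meet hh, hom_join hh, hom_imp hh, hom_neg hh, hom_opI hh, hom_opC hh,
   hom_zero hh, hom_one hh).

Lemma hom_Some (R : algebra) : @homomorphism R (sharp R) Some.
Proof. by split. Qed.

Fixpoint eval {V : Type} {A : algebra} (e : V -> A) (phi : formula V) : A :=
  match phi with
  | Var x => e x
  | And a b => meet (eval e a) (eval e b)
  | Or a b => join (eval e a) (eval e b)
  | Imp a b => imp (eval e a) (eval e b)
  | Neg a => neg (eval e a)
  | FI a => opI (eval e a)
  | FC a => opC (eval e a)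
  | Bot => zero
  | Top => one
  end.

Lemma eval_hom {V : Type} {A : algebra} (e : V -> A) :
  @homomorphism (Fm V) A (eval e).
Proof. by split. Qed.

Lemma hom_ext {V : Type} {A : algebra} {v w : Fm V -> A} {phi : formula V} :
  homomorphism v -> homomorphism w ->
  (forall x, var phi x -> v (Var x) = w (Var x)) -> v phi = w phi.
Proof.
case=> [vm vj vi vn vI vC v0 v1] [wm wj wi wn wI wC w0 w1].
elim: phi => [x|a IHa b IHb|a IHa b IHb|a IHa b IHb|a IHa|a IHa|a IHa||] /= H.
- exact: H.
- by rewrite [LHS]vm [RHS]wm IHa ?IHb // => x xV; apply: H; [right|left].
- by rewrite [LHS]vj [RHS]wj IHa ?IHb // => x xV; apply: H; [right|left].
- by rewrite [LHS]vi [RHS]wi IHa ?IHb // => x xV; apply: H; [right|left].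
- by rewrite [LHS]vn [RHS]wn IHa.
- by rewrite [LHS]vI [RHS]wI IHa.
- by rewrite [LHS]vC [RHS]wC IHa.
- by rewrite [LHS]v0 [RHS]w0.
- by rewrite [LHS]v1 [RHS]w1.
Qed.

(** [Some] embeds [R] into [sharp R], so [v] and [Some \o w] are two homomorphisms into the same
    algebra that agree on the variables of [phi]. *)
Lemma hom_sharp_Some {V : Type} {R : algebra} {v : Fm V -> sharp R}
    {w : Fm V -> R} {phi : formula V} :
  homomorphism v -> homomorphism w ->
  (forall x, var phi x -> v (Var x) = Some (w (Var x))) ->
  v phi = Some (w phi).
Proof.
by move=> hv hw; apply: (@hom_ext _ _ v (Some \o w)) => //;
  apply: hom_comp => //; exact: hom_Some.
Qed.

Lemma hom_sharp_omega {V : Type} {R : algebra} {v : Fm V -> sharp R}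
    {phi : formula V} {x : V} :
  homomorphism v -> var phi x -> v (Var x) = omega -> v phi = omega.
Proof.
case=> [vm vj vi vn vI vC _ _] + vx.
have inf2r f (a : option R) : infectious2 f a None = None by case: a.
elim: phi => [y|a IHa b IHb|a IHa b IHb|a IHa b IHb|a IHa|a IHa|a IHa||] //=.
- by move=> xy; rewrite -[y]xy.
- by case=> [/IHa|/IHb] E; rewrite [LHS]vm E //=; exact: inf2r.
- by case=> [/IHa|/IHb] E; rewrite [LHS]vj E //=; exact: inf2r.
- by case=> [/IHa|/IHb] E; rewrite [LHS]vi E //=; exact: inf2r.
- by move=> /IHa E; rewrite [LHS]vn E.
- by move=> /IHa E; rewrite [LHS]vI E.
- by move=> /IHa E; rewrite [LHS]vC E.
Qed.

Lemma PPRL_entails_of_PRL {V : Type} {Sigma Delta : set (Fm V)} {alpha : Fm V} :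
  Delta `<=` Sigma -> vars Delta `<=` var alpha -> PRL_entails Delta alpha ->
  PPRL_entails Sigma alpha.
Proof.
move=> sDS sDa Da R v hR hv vS.
have [->|va] := pselect (v alpha = omega); first by right.
(* The default [one] is only reached at variables sent to omega; none of these occurs in [alpha],
   since omega would then spread to [v alpha]. *)
pose w : Fm V -> R := eval (fun x => odflt one (v (Var x))).
have hw : homomorphism w := eval_hom _.
have vw phi : var phi `<=` var alpha -> v phi = Some (w phi).
  move=> s; apply: hom_sharp_Some => // x /s xa; rewrite /w /=.
  case E: (v (Var x)) => [//|]; case: va; exact: hom_sharp_omega hv xa E.
left; rewrite vw //= /one /= (Da R w) // => _ [d Dd <-] /=.
(* The variables of [d] lie in [var alpha], so [v d] is [Some (w d)]: omega is excluded and only the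
   value [one] remains. *)
have /vS : (v @` Sigma) (v d) by exists d => //; exact: sDS.
rewrite vw => [[[]|]//|x xd]; by apply: sDa; exists d.
Qed.

Lemma PRL_entails_of_PPRL {V : Type} {Sigma : set (Fm V)} {alpha : Fm V} :
  PPRL_entails Sigma alpha ->
  PRL_entails [set d | Sigma d /\ var d `<=` var alpha] alpha.
Proof.
move=> Sa R v hR hv vD.
pose w : Fm V -> sharp R :=
  eval (fun x => (if `[< var alpha x >] then Some (v (Var x)) else None) : sharp R).
have hw : homomorphism w := eval_hom _.
have wv phi : var phi `<=` var alpha -> w phi = Some (v phi).
  by move=> s; apply: hom_sharp_Some => // x /s xa; rewrite /w /= asboolT.
have := Sa R w hR hw; rewrite wv // => H.
case: H => [_ [d Sd <-]|[]|] //.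
have [s|/existsNP[x /not_implyP[xd nxa]]] := pselect (var d `<=` var alpha).
  by left; rewrite wv //= (vD (v d)) //; exists d.
by right; apply: hom_sharp_omega hw xd _; rewrite /w /= asboolF.
Qed.

Record congruence {A : algebra} (E : A -> A -> Prop) : Prop := Congruence {
  cong_refl : forall a, E a a;
  cong_sym : forall a b, E a b -> E b a;
  cong_trans : forall a b c, E a b -> E b c -> E a c;
  cong_meet : forall a a' b b', E a a' -> E b b' -> E (meet a b) (meet a' b');
  cong_join : forall a a' b b', E a a' -> E b b' -> E (join a b) (join a' b');
  cong_imp : forall a a' b b', E a a' -> E b b' -> E (imp a b) (imp a' b');
  cong_neg : forall a a', E a a' -> E (neg a) (neg a');
  cong_opI : forall a a', E a a' -> E (opI a) (opI a');
  cong_opC : forall a a', E a a' -> E (opC a) (opC a')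
}.

Lemma quotient_exists {A : algebra} {E : A -> A -> Prop} : congruence E ->
  exists (Q : algebra) (p : A -> Q),
    [/\ homomorphism p, forall q, exists a, p a = q
      & forall a b, p a = p b <-> E a b].
Proof.
case=> refl sym trans cm cj ci cn cI cC.
pose T := {S : A -> Prop | exists a, S = E a}.
pose p (a : A) : T := exist _ (E a) (ex_intro _ a erefl).
have pE a b : p a = p b <-> E a b.
  split=> [/(congr1 sval) /= ->|ab]; first exact: refl.
  apply: eq_exist; apply/funext => c; apply/propext.
  by split; apply: trans => //; exact: sym.
(* Each class gets a chosen representative [r q], through which the operations on classes are
   defined; the choice is harmless because [E] is a congruence and [E a (r (p a))]. *)
have ps (q : T) : {a | p a = q}.
  by apply: cid; case: q => S [a Sa]; exists a; exact: eq_exist.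
pose r q := sval (ps q).
have rp a : E a (r (p a)) by apply/pE; rewrite /r; case: (ps (p a)).
exists (@Algebra T (fun x y => p (meet (r x) (r y)))
  (fun x y => p (join (r x) (r y))) (fun x y => p (imp (r x) (r y)))
  (fun x => p (neg (r x))) (fun x => p (opI (r x))) (fun x => p (opC (r x)))
  (p zero) (p one)), p.
split=> [|q|//]; last by case: (ps q) => a; exists a.
by split=> // x *; apply/pE; auto.
Qed.

Lemma PRL_compact {V : Type} {Sigma : set (Fm V)} {alpha : Fm V} :
  PRL_entails Sigma alpha ->
  exists Delta : set (Fm V),
    [/\ finite_set Delta, Delta `<=` Sigma & PRL_entails Delta alpha].
Proof.
move=> Sa.
pose forces (D : set (Fm V)) (a b : Fm V) :=
  forall (R : algebra) (v : Fm V -> R), pre_rough R -> homomorphism v ->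
    v @` D `<=` [set one] -> v a = v b.
pose E a b := exists D, [/\ finite_set D, D `<=` Sigma & forces D a b].
(* [E0], [E1] and [E2] carry inferences with zero, one or two premises from [forces] to [E]. Two
   premises are brought under the union of their finite sets, which still forces both. *)
have E0 a b : forces set0 a b -> E a b by exists set0; split=> // x [].
have E1 a b c d : (forall D, forces D a b -> forces D c d) -> E a b -> E c d.
  by move=> H [D [fD sD Dab]]; exists D; split=> //; exact: H.
have E2 a b a' b' c d :
    (forall D, forces D a b -> forces D a' b' -> forces D c d) ->
    E a b -> E a' b' -> E c d.
  move=> H [D [fD sD Dab]] [D' [fD' sD' Dab']].
  exists (D `|` D'); split; [by rewrite finite_setU | by rewrite subUset |].
  by apply: H => R v hR hv vD; [apply: Dab | apply: Dab'] => // _ [x Dx <-];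
    apply: vD; exists x => //; [left | right].
have congE : congruence E.
  split=> [a|a b|a b c|a a' b b'|a a' b b'|a a' b b'|a a'|a a'|a a'].
  - exact: E0.
  - by apply: E1 => D H R v hR hv vD; rewrite (H R v).
  - by apply: E2 => D H H' R v hR hv vD; rewrite (H R v) ?(H' R v).
  - by apply: E2 => D H H' R v hR hv vD; rewrite !(homE hv) (H R v) ?(H' R v).
  - by apply: E2 => D H H' R v hR hv vD; rewrite !(homE hv) (H R v) ?(H' R v).
  - by apply: E2 => D H H' R v hR hv vD; rewrite !(homE hv) (H R v) ?(H' R v).
  - by apply: E1 => D H R v hR hv vD; rewrite !(homE hv) (H R v).
  - by apply: E1 => D H R v hR hv vD; rewrite !(homE hv) (H R v).
  - by apply: E1 => D H R v hR hv vD; rewrite !(homE hv) (H R v).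
have [Q [p [hp ps pE]]] := quotient_exists congE.
have hQ : pre_rough Q.
  (* An equation valid in all pre-rough algebras is forced by the empty set. It passes to every
     element of [Q] because [p] is onto. *)
  have law a b : (forall R v, pre_rough R -> homomorphism v -> v a = v b :> R) ->
      p a = p b.
    by move=> H; apply: (pE _ _).2; apply: E0 => R v hR hv _; exact: H.
  have pS := homE hp.
  (* Everything but the quasi-identity [imp_one] is an equation. *)
  split; [split; [split|..]|..]; do ?[move=> q; have [? <-] := ps q; move: q => _];
    rewrite -?pS;
    try by apply: law => R v hR hv; rewrite !(homE hv); case: hR => [[[]]] *;
      match goal with H : _ |- _ => exact: H end.
  (* The two premises of the quasi-identity have separate finite witnesses; over their union it can
     be applied in each algebra [R]. *)
  move=> /pE EC /pE EI; apply/pE; move: EC EI.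
  apply: E2 => D HC HI R v hR hv vD; rewrite !(homE hv).
  apply: (imp_one hR).
    by move: (HC R v hR hv vD); rewrite !(homE hv).
  by move: (HI R v hR hv vD); rewrite !(homE hv).
(* [p] is itself a valuation satisfying [Sigma]: each [s] in [Sigma] is identified with [Top]
   through the finite part [[set s]]. *)
have : p alpha = one.
  apply: (Sa _ _ hQ hp) => _ [s Ss <-] /=; rewrite -(hom_one hp); apply/pE.
  exists [set s]; split=> [||R v hR hv vs]; [exact: finite_set1 | by move=> _ -> |].
  by rewrite (hom_one hv); apply: vs; exists s.
rewrite -(hom_one hp) => /pE[D [fD sD Da]]; exists D; split=> // R v hR hv vD.
by rewrite (Da R v) // (hom_one hv).
Qed.

Theorem theorem4p21 (V : Type) (hV : [set: V] #= [set: nat])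
    (Sigma : set (Fm V)) (alpha : Fm V) :
  (PPRL_entails Sigma alpha <->
     exists Delta : set (Fm V),
       [/\ Delta `<=` Sigma, vars Delta `<=` var alpha
         & PRL_entails Delta alpha]) /\
  (PPRL_entails Sigma alpha ->
     exists Delta : set (Fm V),
       [/\ finite_set Delta, Delta `<=` Sigma, vars Delta `<=` var alpha
         & PRL_entails Delta alpha]).
Proof.
have fin : PPRL_entails Sigma alpha ->
    exists Delta : set (Fm V),
      [/\ finite_set Delta, Delta `<=` Sigma, vars Delta `<=` var alpha
        & PRL_entails Delta alpha].
  (* Compactness is applied after restricting to the premises over [var alpha], so the finite subset
     inherits the condition on variables. *)
  move=> /PRL_entails_of_PPRL /PRL_compact[D [fD sD Da]].
  exists D; split=> // [d /sD[]//|x [d /sD[_ s] xd]]; exact: s.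
split=> //; split=> [/fin[D [_ sD vD Da]]|[D [sD vD Da]]]; first by exists D.
exact: PPRL_entails_of_PRL sD vD Da.
Qed.
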